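(* Let $M$ be a simple weight $NS$-module. Assume that there exists $\lambda\in\mathbb{C}$ such that $\dim M_\lambda=\infty$. Then $\mathrm{supp}(M)=\lambda+\frac{\mathbb{Z}}{2}$, and for each $k\in\frac{\mathbb{Z}}{2}$ we have $\dim(M_{\lambda+k})=\infty$.
   Context: The Neveu-Schwarz algebra $NS$ is the complex Lie superalgebra $NS=NS_{\bar 0}\oplus NS_{\bar 1}$, where $NS_{\bar 0}$ has basis $\{L_n, c\mid n\in\mathbb{Z}\}$ and $NS_{\bar 1}$ has basis $\{G_r\mid r\in\frac12+\mathbb{Z}\}$, with relations $[L_m,L_n]=(n-m)L_{m+n}-\delta_{m+n,0}\frac{m^3-m}{12}c$, $[L_m,G_r]=(r-\frac m2)G_{m+r}$, $[G_r,G_s]=2L_{r+s}+\frac{4r^2-1}{12}\delta_{r+s,0}c$, and $[NS,c]=0$, for $m,n\in\mathbb{Z}$, $r,s\in\frac12+\mathbb{Z}$. The bracket of two odd elements is the anticommutator $[G_r,G_s]=G_rG_s+G_sG_r$ in any module. The Cartan subalgebra is $\mathfrak h=\mathbb{C}L_0\oplus\mathbb{C}c$. A weight module is an $NS$-module on which $\mathfrak h$ acts diagonalizably. On a simple weight module $M$, $c$ acts by a scalar and $M=\bigoplus_{\mu\in\mathbb{C}} M_\mu$ with weight spaces $M_\mu=\{v\in M\mid L_0v=\mu v\}$. The support is $\mathrm{supp}(M)=\{\mu\in\mathbb{C}\mid M_\mu\ne0\}$. Here $\frac{\mathbb{Z}}{2}=\{n/2\mid n\in\mathbb{Z}\}$.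 *)

(* Defs.v *)
From HB Require Import structures.
From mathcomp Require Import all_boot all_order all_algebra finmap.
From mathcomp Require Import boolp classical_sets reals.
From mathcomp Require Import complex.
From mathcomp Require Import monalg.
From mathcomp Require Import ring lra zify.

Set Implicit Arguments.
Unset Strict Implicit.
Unset Printing Implicit Defensive.

Import Order.TTheory GRing.Theory Num.Theory.

Local Open Scope ring_scope.

(* Parities are booleans: [false] is even, [true] is odd, and (+) is [addb]. *)
Definition is_superspace (F : fieldType) (V : lmodType F)
    (gr : bool -> {pred V}) : Prop :=
  [/\ forall p, submod_closed (gr p),
      forall v, exists v0 v1,
        [/\ v0 \in gr false, v1 \in gr true & v = v0 + v1]
    & forall v, v \in gr false -> v \in gr true -> v = 0].

(* These axioms are the right ones when 6 is invertible in F, whence the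
   restriction to numFieldType. *)
Record lieSuperalgebra (F : numFieldType) := LieSuperalgebra {
  lsa_sort :> lmodType F;
  lsa_gr : bool -> {pred lsa_sort};
  lsa_br : lsa_sort -> lsa_sort -> lsa_sort;
  lsa_grP : is_superspace lsa_gr;
  lsa_brl : forall y, linear (lsa_br ^~ y);
  lsa_brr : forall x, linear (lsa_br x);
  lsa_br_gr : forall p q x y, x \in lsa_gr p -> y \in lsa_gr q ->
    lsa_br x y \in lsa_gr (p (+) q);
  lsa_skew : forall p q x y, x \in lsa_gr p -> y \in lsa_gr q ->
    lsa_br x y = - ((-1) ^+ (p && q) *: lsa_br y x);
  lsa_jacobi : forall p q x y z, x \in lsa_gr p -> y \in lsa_gr q ->
    lsa_br x (lsa_br y z) =
    lsa_br (lsa_br x y) z + (-1) ^+ (p && q) *: lsa_br y (lsa_br x z)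
}.

Record superModule (F : numFieldType) (g : lieSuperalgebra F) := SuperModule {
  sm_sort :> lmodType F;
  sm_gr : bool -> {pred sm_sort};
  sm_act : g -> sm_sort -> sm_sort;
  sm_grP : is_superspace sm_gr;
  sm_actl : forall v, linear (sm_act ^~ v);
  sm_actr : forall x, linear (sm_act x);
  sm_act_gr : forall p q x v, x \in lsa_gr p -> v \in sm_gr q ->
    sm_act x v \in sm_gr (p (+) q);
  sm_act_br : forall p q x y v, x \in lsa_gr p -> y \in lsa_gr q ->
    sm_act (lsa_br x y) v =
    sm_act x (sm_act y v) - (-1) ^+ (p && q) *: sm_act y (sm_act x v)
}.

(* Submodules of a superspace are graded. *)
Record is_submodule (F : numFieldType) (g : lieSuperalgebra F)
    (M : superModule g) (W : {pred M}) : Prop := IsSubmodule {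
  submodule_closed : submod_closed W;
  submodule_graded : forall v, v \in W -> exists v0 v1,
    [/\ v0 \in W /\ v0 \in sm_gr false,
        v1 \in W /\ v1 \in sm_gr true & v = v0 + v1];
  submodule_stable : forall (x : g) v, v \in W -> sm_act x v \in W
}.

Definition is_simple (F : numFieldType) (g : lieSuperalgebra F)
    (M : superModule g) : Prop :=
  (exists v : M, v != 0) /\
  forall W : {pred M}, is_submodule W ->
    (forall v, v \in W -> v = 0) \/ (forall v, v \in W).

Definition finite_dim (F : fieldType) (V : lmodType F) (W : {pred V}) : Prop :=
  exists n (e : 'I_n -> V), (forall i, e i \in W) /\
    forall v, v \in W -> exists a : 'I_n -> F, v = \sum_(i < n) a i *: e i.

(* [GB n] stands for G_(n + 1/2). *)
Inductive ns_basis := LB of int | CB | GB of int.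

Definition ns_basis_to (i : ns_basis) : int + unit + int :=
  match i with LB n => inl (inl n) | CB => inl (inr tt) | GB n => inr n end.
Definition ns_basis_of (i : int + unit + int) : ns_basis :=
  match i with inl (inl n) => LB n | inl (inr _) => CB | inr n => GB n end.
Lemma ns_basis_toK : cancel ns_basis_to ns_basis_of.
Proof. by case. Qed.

HB.instance Definition _ := Choice.copy ns_basis (can_type ns_basis_toK).

Definition ns_parity (i : ns_basis) : bool := if i is GB _ then true else false.

Section BracketTable.

Variables (F : numFieldType) (V : lmodType F) (e : ns_basis -> V).

Definition half (n : int) : F := n%:~R + 2^-1.

(* The bracket of the basis vectors [e i] and [e j].  Note that if r and s here
   index G_(r + 1/2) and G_(s + 1/2), the two half-integers add up to
   r + s + 1. *)
Definition ns_br_table (i j : ns_basis) : V :=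
  match i, j with
  | LB m, LB n => (n - m)%:~R *: e (LB (m + n))
      - ((m + n == 0)%:R * ((m%:~R ^+ 3 - m%:~R) / 12)) *: e CB
  | LB m, GB r => (half r - m%:~R / 2) *: e (GB (m + r))
  | GB r, LB m => - ((half r - m%:~R / 2) *: e (GB (m + r)))
  | GB r, GB s => 2 *: e (LB (r + s + 1))
      + ((4 * half r ^+ 2 - 1) / 12 * (r + s + 1 == 0)%:R) *: e CB
  | _, _ => 0
  end.

Lemma ns_table_skew i j : ns_br_table i j =
  - ((-1) ^+ (ns_parity i && ns_parity j) *: ns_br_table j i).
Proof.
case: i j => [m||r] [n||s] /=; rewrite ?expr0 ?expr1 ?scaler0 ?oppr0 //
  ?scale1r ?opprK //.
  rewrite [(n + m)%R]addrC opprD opprK -!scaleNr.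
  congr (_ *: _ + _ *: _); first by rewrite -rmorphN opprB.
  case: eqP => [mn|]; last by rewrite !mul0r oppr0.
  have -> : n = - m by lia.
  by rewrite /= rmorphN; field.
rewrite scaleN1r opprK [(s + r)%R]addrC; congr (_ + _ *: _).
case: eqP => [rs|]; last by rewrite !mulr0.
have -> : s = - r - 1 by lia.
by rewrite /half !(rmorphB, rmorphN, rmorph1) /=; field.
Qed.

Variable br : V -> V -> V.
Hypothesis brl : forall y, linear (br ^~ y).
Hypothesis brr : forall x, linear (br x).
Hypothesis brU : forall i j, br (e i) (e j) = ns_br_table i j.

Let br0l x : br 0 x = 0.
Proof. by rewrite -[in LHS](subrr 0) -scaleN1r addrC brl scaleN1r addNr. Qed.
Let br0r x : br x 0 = 0.
Proof. by rewrite -[in LHS](subrr 0) -scaleN1r addrC brr scaleN1r addNr. Qed.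
Let brDr x y z : br x (y + z) = br x y + br x z.
Proof. by rewrite -[y]scale1r brr !scale1r. Qed.
Let brZr x a y : br x (a *: y) = a *: br x y.
Proof. by rewrite -[a *: y]addr0 brr br0r addr0. Qed.
Let brNr x y : br x (- y) = - br x y.
Proof. by rewrite -scaleN1r brZr scaleN1r. Qed.
Let brDl x y z : br (y + z) x = br y x + br z x.
Proof. by rewrite -[y]scale1r brl !scale1r. Qed.
Let brZl x a y : br (a *: y) x = a *: br y x.
Proof. by rewrite -[a *: y]addr0 brl br0l addr0. Qed.
Let brNl x y : br (- y) x = - br y x.
Proof. by rewrite -scaleN1r brZl scaleN1r. Qed.
Let brE := (brDr, brZr, brNr, brDl, brZl, brNl, br0l, br0r, brU).

Let lc1 a b c (x : V) : a = b + c -> a *: x = b *: x + c *: x.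
Proof. by move=> ->; rewrite scalerDl. Qed.
Let lc2 a b c d a' b' (x y : V) : a = c + a' -> b = d + b' ->
  a *: x + b *: y = (c *: x + d *: y) + (a' *: x + b' *: y).
Proof. by move=> -> ->; rewrite !scalerDl addrACA. Qed.

Lemma ns_table_jacobi i j k :
  br (e i) (ns_br_table j k) = br (ns_br_table i j) (e k)
  + (-1) ^+ (ns_parity i && ns_parity j) *: br (e j) (ns_br_table i k).
Proof.
case: i j k => [m||m] [n||n] [l||l] /=; rewrite ?brE /= ?(scalerDr,
  scalerN, scaler0, scalerA, addr0, add0r, oppr0, opprD, opprK) //
  ?expr0 ?expr1 ?mul1r ?scale1r ?mulN1r -?scaleNr.
- have -> : m + (n + l) = m + n + l by ring.
  have -> : n + (m + l) = m + n + l by ring.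
  apply: lc2; first by rewrite /half; field.
  case: (m + n + l =P 0) => [t0|_]; last first.
    by rewrite !(mul0r, mulr0, oppr0, addr0).
  have -> : l = - m - n by lia.
     by rewrite /half; field.
- have -> : m + (n + l) = m + n + l by ring.
  have -> : n + (m + l) = m + n + l by ring.
  by apply: lc1; by rewrite /half; field.
- have -> : m + (l + n) = l + (m + n) by ring.
  have -> : m + l + n = l + (m + n) by ring.
  by apply: lc1; by rewrite /half; field.
- have -> : m + (n + l + 1) = m + n + l + 1 by ring.
  have -> : n + (m + l) + 1 = m + n + l + 1 by ring.
  apply: lc2; first by rewrite /half; field.
  case: (m + n + l + 1 =P 0) => [t0|_]; last first.
    by rewrite !(mul0r, mulr0, oppr0, addr0).
  have -> : l = - m - n - 1 by lia.
     by rewrite /half; field.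
- have -> : l + (n + m) = n + l + m by ring.
  have -> : n + (l + m) = n + l + m by ring.
  by apply: lc1; by rewrite /half; field.
- have -> : m + (n + l) + 1 = n + m + l + 1 by ring.
  have -> : n + (m + l + 1) = n + m + l + 1 by ring.
  apply: lc2; first by rewrite /half; field.
  case: (n + m + l + 1 =P 0) => [t0|_]; last first.
    by rewrite !(mul0r, mulr0, oppr0, addr0).
  have -> : l = - m - n - 1 by lia.
     by rewrite /half; field.
- have -> : m + (l + n) + 1 = m + n + 1 + l by ring.
  have -> : n + (l + m) + 1 = m + n + 1 + l by ring.
  apply: lc2; first by rewrite /half; field.
  case: (m + n + 1 + l =P 0) => [t0|_]; last first.
    by rewrite !(mul0r, mulr0, oppr0, addr0).
  have -> : l = - m - n - 1 by lia.
     by rewrite /half; field.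
- have -> : n + l + 1 + m = m + n + 1 + l by ring.
  have -> : m + l + 1 + n = m + n + 1 + l by ring.
  by apply: lc1; by rewrite /half; field.
Qed.

End BracketTable.

Section NeveuSchwarz.

Variable F : numFieldType.

Let V : lmodType F := {malg F[ns_basis]}.
Let E (k : ns_basis) : V := << k >>.

Definition ns_gr (p : bool) : {pred {malg F[ns_basis]}} :=
  [pred x : {malg F[ns_basis]} | all (fun k => ns_parity k == p) (msupp x)].

Definition ns_br_basis (i j : ns_basis) : {malg F[ns_basis]} :=
  ns_br_table (fun k => << k >>) i j.

Definition lin_ext (h : ns_basis -> {malg F[ns_basis]})
    (x : {malg F[ns_basis]}) : {malg F[ns_basis]} :=
  \sum_(k <- msupp x) x@_k *: h k.

Definition ns_br (x y : {malg F[ns_basis]}) : {malg F[ns_basis]} :=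
  lin_ext (fun i => lin_ext (ns_br_basis i) y) x.

Lemma lin_extE h x (d : {fset ns_basis}) : (msupp x `<=` d)%fset ->
  lin_ext h x = \sum_(k <- d) x@_k *: h k.
Proof.
move=> le_xd; rewrite /lin_ext (big_fset_incl _ le_xd) //=.
move=> k _ /mcoeff_outdom ->.
by rewrite scale0r.
Qed.

Lemma lin_ext_linear h : linear (lin_ext h).
Proof.
move=> a x y.
pose d := (msupp x `|` msupp y `|` msupp (a *: x + y))%fset.
rewrite (@lin_extE h x d); last by rewrite /d -fsetUA fsubsetUl.
rewrite (@lin_extE h y d); last by rewrite /d fsetUAC fsubsetUr.
rewrite (@lin_extE h _ d); last by rewrite /d fsubsetUr.
rewrite scaler_sumr -big_split /=; apply: eq_bigr => k _.
by rewrite mcoeffD mcoeffZ scalerDl scalerA.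
Qed.

Lemma lin_extU h k : lin_ext h << k >> = h k.
Proof. by rewrite /lin_ext msuppU oner_eq0 big_seq_fset1 mcoeffUU scale1r. Qed.

Lemma ns_brl y : linear (ns_br ^~ y).
Proof. exact: lin_ext_linear. Qed.

Lemma ns_brr x : linear (ns_br x).
Proof.
move=> a y z; rewrite /ns_br /lin_ext scaler_sumr -big_split /=.
apply: eq_bigr => k _; rewrite -/(lin_ext _ _) lin_ext_linear scalerDr.
by rewrite !scalerA mulrC.
Qed.

Lemma ns_brU i j : ns_br << i >> << j >> = ns_br_basis i j.
Proof. by rewrite /ns_br !lin_extU. Qed.

Lemma ns_grP p (x : V) :
  (x \in ns_gr p) <-> (forall k, ns_parity k != p -> x@_k = 0).
Proof.
split=> [/allP xp k kp|xp]; last first.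
  apply/allP => k; rewrite -mcoeff_neq0; apply: contraNT => kp.
  by rewrite xp.
by apply: mcoeff_outdom; apply: contra kp => /xp.
Qed.

Lemma ns_gr_closed p : submod_closed (ns_gr p).
Proof.
split=> [|a x y /ns_grP xp /ns_grP yp]; apply/ns_grP => k kp.
  by rewrite mcoeff0.
by rewrite mcoeffD mcoeffZ xp // yp // mulr0 addr0.
Qed.

Lemma ns_grU p k : ns_parity k = p -> E k \in ns_gr p.
Proof.
move=> <-; apply/ns_grP => l lk; rewrite mcoeffU; case: eqP => // kl.
by rewrite kl eqxx in lk.
Qed.

Lemma ns_gr_ind p (P : V -> Prop) : P 0 ->
  (forall a k x, ns_parity k = p -> P x -> P (a *: E k + x)) ->
  forall x, x \in ns_gr p -> P x.
Proof.
move=> P0 PS x /allP xp; rewrite (monalgE x).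
have gen (f : ns_basis -> F) (s : seq ns_basis) :
    {in s, forall k, ns_parity k == p} -> P (\sum_(k <- s) << f k *g k >>).
  elim: s => [|k s IHs] sp; first by rewrite big_nil.
  rewrite big_cons; have -> : << f k *g k >> = f k *: E k.
    by apply/malgP => l; rewrite mcoeffZ !mcoeffU mulr_natr.
  apply: PS; first by apply/eqP/sp/mem_head.
  by apply: IHs => l ls; apply: sp; rewrite in_cons ls orbT.
exact: gen.
Qed.

Lemma ns_ind (P : V -> Prop) : P 0 ->
  (forall a k x, P x -> P (a *: E k + x)) -> forall x, P x.
Proof.
move=> P0 PS x; rewrite (monalgE x).
have gen (f : ns_basis -> F) (s : seq ns_basis) :
    P (\sum_(k <- s) << f k *g k >>).
  elim: s => [|k s IHs]; first by rewrite big_nil.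
  rewrite big_cons; have -> : << f k *g k >> = f k *: E k.
    by apply/malgP => l; rewrite mcoeffZ !mcoeffU mulr_natr.
  exact: PS.
exact: gen.
Qed.

Lemma ns_superspace : is_superspace ns_gr.
Proof.
split=> [|x|x /ns_grP x0 /ns_grP x1]; first exact: ns_gr_closed.
  move: x; apply: ns_ind => [|a k _ [x0 [x1 [x0P x1P ->]]]].
    exists 0, 0; split; rewrite ?addr0 //; apply/ns_grP=> k _; exact: mcoeff0.
  case kp: (ns_parity k).
    exists x0, (a *: E k + x1); split=> //; last by rewrite addrCA.
    by apply: (ns_gr_closed true).2 => //; apply: ns_grU.
  exists (a *: E k + x0), x1; split=> //; last by rewrite addrA.
  by apply: (ns_gr_closed false).2 => //; apply: ns_grU.
apply/malgP=> k; rewrite mcoeff0.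
by case kp: (ns_parity k); [apply: x0|apply: x1]; rewrite kp.
Qed.

Lemma ns_br0l y : ns_br 0 y = 0.
Proof. by rewrite -[in LHS](subrr 0) -scaleN1r addrC ns_brl scaleN1r addNr. Qed.

Lemma ns_br0r x : ns_br x 0 = 0.
Proof. by rewrite -[in LHS](subrr 0) -scaleN1r addrC ns_brr scaleN1r addNr. Qed.

Lemma ns_br_basis_gr i j :
  ns_br_basis i j \in ns_gr (ns_parity i (+) ns_parity j).
Proof.
case: i j => [m||r] [n||s] /=; apply/ns_grP => k kp;
  rewrite ?mcoeff0 ?mcoeffN ?mcoeffD ?mcoeffN ?mcoeffZ ?mcoeffU //;
  by case: k kp => [k||k] //= _; rewrite ?mulr0n ?mulr0 ?oppr0 ?addr0.
Qed.

Lemma ns_br_gr p q x y : x \in ns_gr p -> y \in ns_gr q ->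
  ns_br x y \in ns_gr (p (+) q).
Proof.
move=> xp yq; move: x xp; apply: ns_gr_ind => [|a i x ip IHx].
  by rewrite ns_br0l; exact: (ns_gr_closed _).1.
rewrite ns_brl; apply: (ns_gr_closed _).2 => //; clear x IHx.
move: y yq; apply: ns_gr_ind => [|b j y jq IHy].
  by rewrite ns_br0r; exact: (ns_gr_closed _).1.
rewrite ns_brr; apply: (ns_gr_closed (p (+) q)).2; last exact: IHy.
by rewrite ns_brU -ip -jq ns_br_basis_gr.
Qed.

Let brDr x y z : ns_br x (y + z) = ns_br x y + ns_br x z.
Proof. by rewrite -[y]scale1r ns_brr !scale1r. Qed.
Let brZr x a y : ns_br x (a *: y) = a *: ns_br x y.
Proof. by rewrite -[a *: y]addr0 ns_brr ns_br0r addr0. Qed.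
Let brNr x y : ns_br x (- y) = - ns_br x y.
Proof. by rewrite -scaleN1r brZr scaleN1r. Qed.
Let brDl x y z : ns_br (y + z) x = ns_br y x + ns_br z x.
Proof. by rewrite -[y]scale1r ns_brl !scale1r. Qed.
Let brZl x a y : ns_br (a *: y) x = a *: ns_br y x.
Proof. by rewrite -[a *: y]addr0 ns_brl ns_br0l addr0. Qed.
Let brNl x y : ns_br (- y) x = - ns_br y x.
Proof. by rewrite -scaleN1r brZl scaleN1r. Qed.
Let brE := (brDr, brZr, brNr, brDl, brZl, brNl, ns_br0l, ns_br0r, ns_brU).

Lemma ns_br_skew p q x y : x \in ns_gr p -> y \in ns_gr q ->
  ns_br x y = - ((-1) ^+ (p && q) *: ns_br y x).
Proof.
move=> xp yq; move: x xp; apply: ns_gr_ind => [|a i x ip IHx].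
  by rewrite ns_br0l ns_br0r scaler0 oppr0.
rewrite ns_brl ns_brr IHx.
rewrite scalerDr opprD; congr (_ + _); clear x IHx.
rewrite scalerA mulrC -scalerA -scalerN; congr (_ *: _).
move: y yq; apply: ns_gr_ind => [|b j y jq IHy].
  by rewrite ns_br0l ns_br0r scaler0 oppr0.
rewrite ns_brl ns_brr IHy scalerDr opprD; congr (_ + _).
rewrite scalerA mulrC -scalerA -scalerN; congr (_ *: _).
by rewrite !ns_brU /ns_br_basis ns_table_skew ip jq.
Qed.

Lemma ns_br_jacobi p q x y z : x \in ns_gr p -> y \in ns_gr q ->
  ns_br x (ns_br y z) =
  ns_br (ns_br x y) z + (-1) ^+ (p && q) *: ns_br y (ns_br x z).
Proof.
have dist a (u v : V) c : a *: (u + c *: v) = a *: u + c *: (a *: v).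
  by rewrite scalerDr !scalerA mulrC.
move=> xp yq; move: x xp; apply: ns_gr_ind => [|a i x ip IHx].
  by rewrite !brE scaler0 addr0.
rewrite !brE IHx.
rewrite scalerDr addrACA; congr (_ + _).
clear x IHx; rewrite -dist; congr (_ *: _).
move: y yq; apply: ns_gr_ind => [|b j y jq IHy].
  by rewrite !brE scaler0 addr0.
rewrite !brE IHy.
rewrite scalerDr addrACA; congr (_ + _).
clear y IHy; rewrite -dist; congr (_ *: _).
move: z; apply: ns_ind => [|c k z IHz]; first by rewrite !brE scaler0 addr0.
rewrite !brE IHz.
rewrite scalerDr addrACA; congr (_ + _).
clear z IHz; rewrite -dist; congr (_ *: _).
by rewrite -ip -jq; exact: (ns_table_jacobi ns_brl ns_brr ns_brU).
Qed.

End NeveuSchwarz.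

Definition NS (F : numFieldType) : lieSuperalgebra F :=
  LieSuperalgebra (@ns_superspace F) (@ns_brl F) (@ns_brr F) (@ns_br_gr F)
    (@ns_br_skew F) (@ns_br_jacobi F).

Section WeightModules.

Variables (F : numFieldType) (M : superModule (NS F)).

Definition ns_L0 : NS F := << LB 0 >> : {malg F[ns_basis]}.
Definition ns_c : NS F := << CB >> : {malg F[ns_basis]}.

Definition cartan (h : NS F) : Prop := exists a b, h = a *: ns_L0 + b *: ns_c.

Definition is_weight_vector (v : M) : Prop :=
  forall h, cartan h -> exists s : F, sm_act h v = s *: v.

(* The sum of the simultaneous eigenspaces is automatically direct, so it
   suffices to ask that it be everything. *)
Definition is_weight_module : Prop :=
  forall v : M, exists n (w : 'I_n -> M),
    (forall i, is_weight_vector (w i)) /\ v = \sum_(i < n) w i.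

Definition weight_space (mu : F) : {pred M} :=
  [pred v : M | sm_act ns_L0 v == mu *: v].

Definition supp : set F :=
  [set mu | exists2 v : M, v \in weight_space mu & v != 0]%classic.

End WeightModules.

Arguments weight_space {F} M mu.
Arguments supp {F} M.

Definition half_integers (F : numFieldType) : set F :=
  [set n%:~R / 2 | n in [set: int]]%classic.

Arguments half_integers F : clear implicits.

(* Main.v *)
Require Import Defs.
From HB Require Import structures.
From mathcomp Require Import all_boot all_order all_algebra.
From mathcomp Require Import classical_sets reals complex.
From mathcomp Require Import boolp monalg ring zify.

(* Write a, b, a', b' for G_(1/2), G_(3/2), G_(-1/2), G_(-3/2); they generate NS.
   It suffices to show that M_p cannot be infinite-dimensional when M_(p+1/2) is
   finite-dimensional: the mirror image with a, b and a', b' exchanged then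
   handles M_(p-1/2), and induction reaches every weight in lambda + Z/2.
   If M_p were infinite-dimensional and M_(p+1/2) finite-dimensional, some
   nonzero homogeneous v in M_p would be killed by any prescribed finite set of
   words of weight 1/2 in the generators.  Imposing seven such words produces
   vectors v and z, not both 0, of weights (p, p + 1), (p, p + 3/2) or
   (p - 1/2, p + 1), such that a v = 0, a' z = 0, b v is a multiple of z or a z,
   and b' z is a multiple of v or a' v.  Then U(n_-) v + U(n_+) z is a
   submodule, hence everything, and its weight space of weight p is at most a
   line. *)

Set Implicit Arguments.
Unset Strict Implicit.
Unset Printing Implicit Defensive.

Import Order.TTheory GRing.Theory Num.Theory.

Local Open Scope ring_scope.

(** * Linear spans and eigenvectors *)

Section Span.

Variables (F : fieldType) (V : lmodType F).
Implicit Types (S T : V -> Prop) (f : {linear V -> V}) (x y : V).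

Inductive lspan S : V -> Prop :=
| span_nil : lspan S 0
| span_cons k x y : S x -> lspan S y -> lspan S (k *: x + y).

Lemma span_mem S x : S x -> lspan S x.
Proof.
by move=> Sx; rewrite -[x]scale1r -[_ *: _]addr0; apply: span_cons => //; left.
Qed.

Lemma spanD S x y : lspan S x -> lspan S y -> lspan S (x + y).
Proof.
move=> + Sy; elim=> [|k u w Su _ IHw]; first by rewrite add0r.
by rewrite -addrA; apply: span_cons.
Qed.

Lemma spanZ S k x : lspan S x -> lspan S (k *: x).
Proof.
elim=> [|l u w Su _ IHw]; first by rewrite scaler0; left.
by rewrite scalerDr scalerA; apply: span_cons.
Qed.

Lemma spanB S x y : lspan S x -> lspan S y -> lspan S (x - y).
Proof. by move=> Sx Sy; rewrite -scaleN1r; apply/spanD/spanZ. Qed.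

Lemma span_map S T f : (forall x, S x -> lspan T (f x)) ->
  forall x, lspan S x -> lspan T (f x).
Proof.
move=> ST x; elim=> [|k u w Su _ IHw]; first by rewrite linear0; left.
by rewrite linearP; apply/spanD => //; apply/spanZ/ST.
Qed.

Lemma span_trans S T : (forall x, S x -> lspan T x) ->
  forall x, lspan S x -> lspan T x.
Proof. exact: (@span_map S T idfun). Qed.

(** With [a'], [b'] for [f], [g], these words applied to [v] span U(n_-) v. *)
Inductive orbit2 (f g : V -> V) (v : V) : V -> Prop :=
| orbit2_id : orbit2 f g v v
| orbit2_l x : orbit2 f g v x -> orbit2 f g v (f x)
| orbit2_r x : orbit2 f g v x -> orbit2 f g v (g x).

(** Peeling off the terms of [x], a product of factors [f - nu] kills [x], but on a [mu]-eigenvector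
    it acts as the product of the nonzero scalars [mu - nu]. *)
Lemma span_eigen_neq S f mu :
  (forall x, S x -> exists2 nu, nu != mu & f x = nu *: x) ->
  forall x, lspan S x -> f x = mu *: x -> x = 0.
Proof.
move=> Snu x Sx fx; pose act s y := foldr (fun nu u => f u - nu *: u) y s.
have [s smu sx]: exists2 s, mu \notin s & act s x = 0.
  elim: Sx {fx} => [|k u w /Snu[nu numu fu] _ [s smu sw]].
    by exists [::].
  exists (rcons s nu); first by rewrite mem_rcons in_cons eq_sym negb_or numu.
  rewrite /act foldr_rcons linearP fu scalerDr !scalerA [k * nu]mulrC.
  rewrite opprD addrACA subrr add0r -/(act _ _).
  have -> : act s (f w - nu *: w) = f (act s w) - nu *: act s w.
    elim: s {smu sw} => //= la s ->; rewrite !linearB !linearZ /= !scalerA.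
    by rewrite [nu * la]mulrC -!addrA; congr (_ + _); rewrite addrCA.
  by rewrite sw linear0 scaler0 subrr.
suff {sx} : act s x = (\prod_(nu <- s) (mu - nu)) *: x.
  rewrite sx => /esym/eqP; rewrite scaler_eq0 => /orP[|/eqP//].
  rewrite prodf_seq_eq0 => /hasP[nu nus] /=; rewrite subr_eq0 => /eqP numu.
  by rewrite numu nus in smu.
elim: s {smu} => [|nu s IHs]; first by rewrite big_nil scale1r.
by rewrite /= IHs linearZ /= fx big_cons !scalerA mulrBl scalerBl [_ * mu]mulrC.
Qed.

Definition thin f mu := exists v, forall x, f x = mu *: x -> exists k, x = k *: v.

(** Modulo [v], every vector is a combination of eigenvectors for other eigenvalues, and
    [span_eigen_neq] applies. *)
Lemma thin_span S f mu v : (forall x, lspan S x) -> f v = mu *: v ->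
  (forall x, S x -> x = v \/ exists2 nu, nu != mu & f x = nu *: x) ->
  thin f mu.
Proof.
move=> Sall fv SP; exists v => x fx.
have [k]: exists k, lspan (fun y => exists2 nu, nu != mu & f y = nu *: y) (x - k *: v).
  elim: (Sall x) => [|l u w /SP Su _ [k IHw]].
    by exists 0; rewrite scale0r subr0; left.
  case: Su => [->|Su].
    by exists (l + k); rewrite scalerDl opprD addrACA subrr add0r.
  by exists k; rewrite -addrA; apply: span_cons.
move=> xk; exists k; apply/eqP; rewrite -subr_eq0; apply/eqP.
apply: (@span_eigen_neq _ f mu _ _ xk) => //.
by rewrite linearB linearZ /= fx fv scalerBr !scalerA [mu * k]mulrC.
Qed.

End Span.

(** * Modules described by the generators a, b, a', b' *)

Section Representations.

Variables (F : numFieldType) (V : lmodType F) (gr : bool -> V -> Prop) (d : F).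

(* Relations between G_(+-1/2) and G_(+-3/2) in a simple module: h = 1/2 for
   a = G_(1/2) and h = -1/2 for the mirror image, and d = 2c/3.  The relations
   rep_aaab, rep_aaab' say that [L_1, L_2] = L_3 and [L_-1, L_-2] = - L_-3. *)
Record ns_rep (h : F) (L0 a b a' b' : {linear V -> V}) : Prop := NsRep {
  rep_step : h != 0;
  rep_aa' : forall x, a (a' x) + a' (a x) = 2 *: L0 x;
  rep_ab' : forall x, a (b' x) + b' (a x) = 2 *: a' (a' x);
  rep_ba' : forall x, b (a' x) + a' (b x) = 2 *: a (a x);
  rep_bb' : forall x, b (b' x) + b' (b x) = 2 *: L0 x + d *: x;
  rep_L0a : forall x, L0 (a x) = a (L0 x) + h *: a x;
  rep_L0b : forall x, L0 (b x) = b (L0 x) + (3 * h) *: b x;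
  rep_L0a' : forall x, L0 (a' x) = a' (L0 x) - h *: a' x;
  rep_L0b' : forall x, L0 (b' x) = b' (L0 x) - (3 * h) *: b' x;
  rep_aaab : forall x,
    a (a (a (b x) + b (a x))) - (a (b (a (a x))) + b (a (a (a x)))) =
    (4 * h) *: b (b x);
  rep_aaab' : forall x,
    a' (a' (a' (b' x) + b' (a' x))) -
      (a' (b' (a' (a' x))) + b' (a' (a' (a' x)))) = - ((4 * h) *: b' (b' x));
  rep_gra : forall p x, gr p x -> gr (~~ p) (a x);
  rep_grb : forall p x, gr p x -> gr (~~ p) (b x);
  rep_gra' : forall p x, gr p x -> gr (~~ p) (a' x);
  rep_grb' : forall p x, gr p x -> gr (~~ p) (b' x);
  rep_grP : forall p k x y, gr p x -> gr p y -> gr p (k *: x + y);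
  rep_irr : forall S : V -> Prop, (forall x, S x -> exists p, gr p x) ->
    (forall x, S x -> [/\ lspan S (L0 x), lspan S (a x), lspan S (b x),
                          lspan S (a' x) & lspan S (b' x)]) ->
    (exists2 x, S x & x != 0) -> forall x, lspan S x
}.

(** Exchanging raising and lowering generators only flips the sign of [h], so each lemma for general
    [h] also holds in mirror image. *)
Lemma ns_rep_swap h L0 a b a' b' :
  ns_rep h L0 a b a' b' -> ns_rep (- h) L0 a' b' a b.
Proof.
case=> h0 aa ab ba bb La Lb La' Lb' s s' ga gb ga' gb' grP irr.
split=> // [|x|x|x|x|x|x|x|x|x|x|S Sgr Sst].
- by rewrite oppr_eq0.
- by rewrite addrC.
- by rewrite addrC.
- by rewrite addrC.
- by rewrite addrC.
- by rewrite La' scaleNr.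
- by rewrite Lb' mulrN scaleNr.
- by rewrite La scaleNr opprK.
- by rewrite Lb mulrN scaleNr opprK.
- by rewrite s' mulrN scaleNr.
- by rewrite s mulrN scaleNr opprK.
- by apply: irr => // x /Sst[].
Qed.

(** * Submodules generated by two vectors *)

Section Orbit.

Variables (h : F) (L0 a b a' b' : {linear V -> V}).
Hypothesis rep : ns_rep h L0 a b a' b'.

(** [a'] shifts the weight by [- h] and [b'] by [- 3 * h], so a nonempty word moves it by a positive
    multiple of [- h]. *)
Lemma orbit2_weight p v x : L0 v = p *: v -> orbit2 a' b' v x ->
  x = v \/ exists n : nat, L0 x = (p - n.+1%:R * h) *: x.
Proof.
move=> L0v; elim=> [|{}x _ IHx|{}x _ IHx]; first by left.
  right; case: IHx => [->|[n L0x]].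
    by exists 0; rewrite (rep_L0a' rep) L0v linearZ -scalerBl mul1r.
  exists n.+1; rewrite (rep_L0a' rep) L0x linearZ -scalerBl; congr (_ *: _).
  by rewrite -natr1; ring.
right; case: IHx => [->|[n L0x]].
  by exists 2; rewrite (rep_L0b' rep) L0v linearZ -scalerBl.
exists n.+3; rewrite (rep_L0b' rep) L0x linearZ -scalerBl; congr (_ *: _).
by rewrite -[n.+4]addn3 natrD; ring.
Qed.

Lemma orbit2_homog v x : (exists p, gr p v) -> orbit2 a' b' v x ->
  exists p, gr p x.
Proof.
move=> vp; elim=> // {}x _ [p xp]; exists (~~ p).
  exact: rep_gra' rep _ _ xp.
exact: rep_grb' rep _ _ xp.
Qed.

Lemma orbit2_L0 p v x : L0 v = p *: v -> orbit2 a' b' v x ->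
  exists q, L0 x = q *: x.
Proof.
by move=> L0v /(orbit2_weight L0v)[->|[n ->]]; [exists p | eexists].
Qed.

Lemma orbit2_span v f x : f = a' \/ f = b' ->
  lspan (orbit2 a' b' v) x -> lspan (orbit2 a' b' v) (f x).
Proof.
by case=> ->; apply: span_map => y yP; apply: span_mem; constructor.
Qed.

Variables (p q : F) (v z : V).
Hypotheses (L0v : L0 v = p *: v) (L0z : L0 z = q *: z).
Hypotheses (av : a v = 0) (a'z : a' z = 0).

(** By [rep_aa'] and [rep_ab'], [a] moves right past each letter, leaving only scalars and words in
    [a'], [b'], until it meets [v]. *)
Lemma orbit2_a x : lspan (orbit2 a' b' v) x -> lspan (orbit2 a' b' v) (a x).
Proof.
apply: span_map => {}x; elim=> [|y yP IHy|y yP IHy].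
- by rewrite av; left.
- have -> : a (a' y) = 2 *: L0 y - a' (a y) by rewrite -(rep_aa' rep) addrK.
  have [r ->] := orbit2_L0 L0v yP.
  apply: spanB; first by do 2!apply: spanZ; apply: span_mem.
  by apply: orbit2_span IHy; left.
have -> : a (b' y) = 2 *: a' (a' y) - b' (a y) by rewrite -(rep_ab' rep) addrK.
apply: spanB; last by apply: orbit2_span IHy; right.
by apply/spanZ/span_mem; do 2!constructor.
Qed.

Hypothesis bv : exists k l, b v = k *: z + l *: a z.
Hypothesis b'z : exists k l, b' z = k *: v + l *: a' v.

Let S x := [\/ orbit2 a' b' v x, x = z | x = a z].

Let S_orbit x : lspan (orbit2 a' b' v) x -> lspan S x.
Proof. by apply: span_trans => y yP; apply: span_mem; constructor. Qed.

(** [b] moves right past [a'] at the cost of [a a] and past [b'] at the cost of a scalar, until it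
    meets [v]. The span of [S] is preserved by [a'] and [b']: [a' a z] is a multiple of [z], and
    [b' a z = - a b' z] is in the span of the orbit. *)
Lemma orbit2_b x : orbit2 a' b' v x -> lspan S (b x).
Proof.
have b'zP : lspan (orbit2 a' b' v) (b' z).
  have [k [l ->]] := b'z; apply: spanD; apply/spanZ/span_mem; last constructor.
    by constructor.
  by constructor.
have Sa' y : lspan S y -> lspan S (a' y).
  apply: span_map => {}y [yP|->|->]; last first.
  - have -> : a' (a z) = (2 * q) *: z.
      by rewrite -scalerA -L0z -(rep_aa' rep) a'z linear0 add0r.
    by apply/spanZ/span_mem; constructor 2.
  - by rewrite a'z; left.
  - by apply/span_mem; constructor; apply: orbit2_l.
have Sb' y : lspan S y -> lspan S (b' y).
  apply: span_map => {}y [yP|->|->]; last first.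
  - have -> : b' (a z) = - a (b' z).
      by apply/eqP; rewrite -addr_eq0 addrC (rep_ab' rep) a'z !linear0.
    by rewrite -scaleN1r; apply/spanZ/S_orbit/orbit2_a.
  - exact: S_orbit.
  - by apply/span_mem; constructor; apply: orbit2_r.
elim=> [|y yP IHy|y yP IHy].
- have [k [l ->]] := bv; apply: spanD; apply/spanZ/span_mem.
    by constructor 2.
  by constructor 3.
- have -> : b (a' y) = 2 *: a (a y) - a' (b y) by rewrite -(rep_ba' rep) addrK.
  apply: spanB; last exact: Sa'.
  by apply/spanZ/S_orbit/orbit2_a/orbit2_a/span_mem.
have -> : b (b' y) = 2 *: L0 y + d *: y - b' (b y).
  by rewrite -(rep_bb' rep) addrK.
have [r ->] := orbit2_L0 L0v yP.
apply: spanB; last exact: Sb'.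
apply: spanD; last by apply/spanZ/S_orbit/span_mem.
by do 2!apply: spanZ; apply/S_orbit/span_mem.
Qed.

End Orbit.

(** * Vectors that force thin weight spaces *)

Section Thinness.

Variables (h : F) (L0 a b a' b' : {linear V -> V}).
Hypothesis rep : ns_rep h L0 a b a' b'.

(* M = U(n_-) v + U(n_+) z, with z = 0 when v is a highest weight vector. *)
Lemma thin_pair p v z j : (j == 2) || (j == 3) ->
  L0 v = p *: v -> L0 z = (p + j%:R * h) *: z ->
  (exists e, gr e v) -> (exists e, gr e z) -> (v != 0) || (z != 0) ->
  a v = 0 -> a' z = 0 ->
  (exists k l, b v = k *: z + l *: a z) ->
  (exists k l, b' z = k *: v + l *: a' v) ->
  thin L0 p /\ thin L0 (p + 2 * h).
Proof.
move=> j23 L0v L0z grv grz vz0 av a'z bv b'z.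
have h0 := rep_step rep.
(* The weights to be separated differ by positive multiples of [h]. *)
have nz (n : nat) (x y : F) : x - y = n.+1%:R * h -> x != y.
  by move=> xy; rewrite -subr_eq0 xy mulf_neq0 // pnatr_eq0.
pose S x := orbit2 a' b' v x \/ orbit2 a b z x.
have Sl x : lspan (orbit2 a' b' v) x -> lspan S x.
  by apply: span_trans => y yP; apply: span_mem; left.
have Sr x : lspan (orbit2 a b z) x -> lspan S x.
  by apply: span_trans => y yP; apply: span_mem; right.
have rep' := ns_rep_swap rep.
have Sall x : lspan S x.
  apply: (rep_irr rep) x => [x [|]|x [xP|xP]|].
  - exact: orbit2_homog rep _ _ grv.
  - exact: orbit2_homog rep' _ _ grz.
  - split.
    + have [r ->] := orbit2_L0 rep L0v xP; apply/spanZ/Sl.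
      exact: span_mem.
    + by apply/Sl/(orbit2_a rep L0v av)/span_mem.
    + apply: span_trans (orbit2_b rep L0v L0z av a'z bv b'z xP) => y [yP|->|->].
      * by apply/Sl/span_mem.
      * by apply/Sr/span_mem; constructor.
      * by apply/Sr/span_mem; do 2!constructor.
    + by apply/Sl/span_mem; constructor.
    + by apply/Sl/span_mem; constructor.
  - split.
    + have [r ->] := orbit2_L0 rep' L0z xP; apply/spanZ/Sr.
      exact: span_mem.
    + by apply/Sr/span_mem; constructor.
    + by apply/Sr/span_mem; constructor.
    + by apply/Sr/(orbit2_a rep' L0z a'z)/span_mem.
    + apply: span_trans (orbit2_b rep' L0z L0v a'z av b'z bv xP) => y [yP|->|->].
      * by apply/Sr/span_mem.
      * by apply/Sl/span_mem; constructor.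
      * by apply/Sl/span_mem; do 2!constructor.
  - case/orP: vz0 => ?; [exists v|exists z] => //.
      by left; constructor.
    by right; constructor.
(* The mirror image starts at weight [p + 2 * h] and needs the conclusion at [p], whence the two
   weights. *)
split.
  apply: (thin_span Sall L0v) => x [/(orbit2_weight rep L0v)|].
    case=> [->|[n xw]]; first by left.
    right; exists (p - n.+1%:R * h) => //.
    by rewrite eq_sym; apply: (nz n); rewrite opprB addrC subrK.
  move=> /(orbit2_weight rep' L0z)[->|[n xw]]; right.
    exists (p + j%:R * h) => //.
    by case/orP: j23 => /eqP->; [apply: (nz 1)|apply: (nz 2)]; ring.
  eexists; last exact: xw.
  apply: (nz (n + j)); rewrite -[(n + j).+1]addSn natrD; ring.
(* Among the spanning vectors only [z] can have weight [p + 2 * h], and only for [j] = 2; for [j] =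
   3 this weight space is 0. *)
pose u := if j == 2 then z else 0.
have L0u : L0 u = (p + 2 * h) *: u.
  rewrite /u; case: eqP L0z => [->|] // _ _; by rewrite linear0 scaler0.
apply: (thin_span Sall L0u) => x [/(orbit2_weight rep L0v)|].
  case=> [->|[n xw]]; right.
    by exists p => //; rewrite eq_sym; apply: (nz 1); ring.
  exists (p - n.+1%:R * h) => //.
  rewrite eq_sym; apply: (nz n.+2); rewrite -[n.+3]addn2 natrD; ring.
move=> /(orbit2_weight rep' L0z)[->|[n xw]].
  rewrite /u; case: eqP j23 L0z => [_ _ _|_ /= /eqP-> xw]; first by left.
  by right; eexists; last exact: xw; apply: (nz 0); ring.
right; eexists; last exact: xw.
case/orP: j23 => /eqP->; [apply: (nz n)|apply: (nz n.+1)].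
  ring.
by rewrite -[n.+2]addn1 natrD; ring.
Qed.

Lemma L0_bw p v : L0 v = p *: v -> L0 (b v) = (p + 3 * h) *: b v.
Proof. by move=> L0v; rewrite (rep_L0b rep) L0v linearZ -scalerDl. Qed.

(** Since [a v = 0], [rep_aaab] turns [(4 * h) *: b (b v)] into [a a a b v]. Moving [b'] through the
    three [a] yields [b' b b v = a' a b v]; [rep_bb'] and [rep_aa'] conclude. *)
Lemma rep_bb'b v : a v = 0 -> b' (a (b v)) = 0 ->
  b (b' (b v)) = d *: b v + a (a' (b v)).
Proof.
move=> av b'abv; set y := b v in b'abv *.
(* For [h] = 1/2 this is [L_-1, G_(1/2)] = G_(-1/2). *)
have comm u : a' (a' (a u)) = a (a' (a' u)) + (2 * h) *: a' u.
  have e1 : a' (a u) = 2 *: L0 u - a (a' u) by rewrite -(rep_aa' rep) addrAC subrr add0r.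
  have e2 : a' (a (a' u)) = 2 *: L0 (a' u) - a (a' (a' u)).
    by rewrite -(rep_aa' rep) addrAC subrr add0r.
  rewrite e1 linearB linearZ /= e2 (rep_L0a' rep) scalerBr scalerA.
  by rewrite !opprB addrCA [X in _ + X]addrC subrK.
have e3 u : b' (a u) = 2 *: a' (a' u) - a (b' u).
  by rewrite -(rep_ab' rep) addrAC subrr add0r.
have h4 : 4 * h != 0 by rewrite mulf_neq0 ?(rep_step rep) ?pnatr_eq0.
have b'by : b' (b y) = a' (a y).
  apply: (scalerI h4); rewrite -linearZ /= -(rep_aaab rep) av !linear0 !addr0 subr0.
  rewrite e3 comm e3 b'abv linear0 subr0 linearZ /= scalerDr addrAC subrr add0r.
  by rewrite scalerA mulrA -natrM.
apply: (addIr (b' (b y))); rewrite (rep_bb' rep) b'by.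
by rewrite -addrA (rep_aa' rep) addrC.
Qed.

Lemma rep_ab'b v : b' (a (b v)) = 0 -> a' (a' (b v)) = 0 -> a (b' (b v)) = 0.
Proof.
by move=> b'abv a'a'bv; rewrite -[LHS]addr0 -b'abv (rep_ab' rep) a'a'bv scaler0.
Qed.

Lemma L0_b'bw p v : L0 v = p *: v -> L0 (b' (b v)) = p *: b' (b v).
Proof.
move=> /L0_bw L0y; rewrite (rep_L0b' rep) L0y linearZ -scalerBl.
by congr (_ *: _); ring.
Qed.

Lemma L0_a'bw p v : L0 v = p *: v -> L0 (a' (b v)) = (p + 2 * h) *: a' (b v).
Proof.
move=> /L0_bw L0y; rewrite (rep_L0a' rep) L0y linearZ -scalerBl.
by congr (_ *: _); ring.
Qed.

Lemma homog0 v : (exists e, gr e v) -> exists e, gr e 0.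
Proof.
case=> e ev; exists e; have := rep_grP rep (-1) ev ev.
by rewrite scaleN1r addNr.
Qed.

Lemma homog_b'bB v k : (exists e, gr e v) -> exists e, gr e (b' (b v) - k *: v).
Proof.
case=> e ev; exists e; rewrite addrC -scaleNr.
apply: (rep_grP rep) => //; rewrite -[e]negbK.
exact/(rep_grb' rep)/(rep_grb rep).
Qed.

Lemma homog_a'b e v : gr e v -> gr e (a' (b v)).
Proof. by move=> ev; rewrite -[e]negbK; apply/(rep_gra' rep)/(rep_grb rep). Qed.

(* [b' b v - d v] is killed by [a] and [b]; it is thus 0 or a highest weight
   vector.  In the first case [v] and [b v] generate M as in [thin_pair]. *)
Lemma thin_degenerate p v : L0 v = p *: v -> (exists e, gr e v) -> v != 0 ->
  a v = 0 -> a' (b v) = 0 -> b' (a (b v)) = 0 ->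
  thin L0 p /\ thin L0 (p + 2 * h).
Proof.
move=> L0v grv v0 av a'bv b'abv.
have := rep_bb'b av b'abv; rewrite a'bv linear0 addr0 => bb'bv.
have ab'bv : a (b' (b v)) = 0 by apply: rep_ab'b; rewrite ?a'bv ?linear0.
have [/eqP|w0] := eqVneq (b' (b v) - d *: v) 0.
  rewrite subr_eq0 => /eqP b'bv.
  apply: (@thin_pair p v (b v) 3) => //.
  - exact: L0_bw.
  - by case: grv => e ev; exists (~~ e); exact: (rep_grb rep).
  - by rewrite v0.
  - by exists 1, 0; rewrite scale1r scale0r addr0.
  - by exists d, 0; rewrite scale0r addr0.
apply: (@thin_pair p (b' (b v) - d *: v) 0 2) => //.
- by rewrite linearB linearZ /= (L0_b'bw L0v) L0v scalerBr !scalerA [p * d]mulrC.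
- by rewrite linear0 scaler0.
- exact: homog_b'bB.
- exact: homog0 grv.
- by rewrite w0.
- by rewrite linearB linearZ /= ab'bv av scaler0 subr0.
- by rewrite linear0.
- by exists 0, 0; rewrite linearB linearZ /= bb'bv subrr !scale0r addr0.
- by exists 0, 0; rewrite linear0 !scale0r addr0.
Qed.

(* If not 0, [b' b v - (d + 2 (p + 2 h)) v] satisfies the assumptions of
   [thin_degenerate]. *)
Lemma thin_or_scalar p v : L0 v = p *: v -> (exists e, gr e v) ->
  a v = 0 -> a' (a' (b v)) = 0 -> b' (a (b v)) = 0 ->
  a (a (b' (a' (b v)))) = 0 ->
  thin L0 p /\ thin L0 (p + 2 * h) \/
  b' (b v) = (d + 2 * (p + 2 * h)) *: v /\
  a (a' (b v)) = (2 * (p + 2 * h)) *: b v.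
Proof.
move=> L0v grv av a'a'bv b'abv aab'z.
set k := 2 * (p + 2 * h); set z := a' (b v).
have a'az : a' (a z) = k *: z.
  apply: (addrI (a (a' z))); rewrite (rep_aa' rep) (L0_a'bw L0v) scalerA.
  by rewrite a'a'bv linear0 add0r.
set w := b' (b v) - (d + k) *: v.
have bw : b w = a z - k *: b v.
  rewrite linearB linearZ /= rep_bb'b // scalerDl opprD.
  by rewrite addrACA subrr add0r.
have [w0|w0] := eqVneq w 0; [right|left].
  split; apply/eqP; rewrite -subr_eq0; first by rewrite -/w w0.
  by rewrite -/z -bw w0 linear0.
apply: thin_degenerate w0 _ _ _.
- rewrite linearB linearZ /= (L0_b'bw L0v) L0v scalerBr !scalerA.
  by rewrite [p * _]mulrC.
- exact: homog_b'bB.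
- by rewrite linearB linearZ /= rep_ab'b // av scaler0 subr0.
- by rewrite bw linearB linearZ /= a'az subrr.
rewrite bw linearB linearZ /= linearB linearZ /= b'abv scaler0 subr0.
(* Exchanging [b'] and [a] costs [2 a' a'], which vanishes on [a z] and on [z]; this reduces
   [b' a a z] to [a a b' z = 0]. *)
apply: (addrI (a (b' (a z)))); rewrite (rep_ab' rep) a'az linearZ /= a'a'bv.
rewrite !scaler0 addr0; have -> : b' (a z) = - a (b' z).
  by apply/eqP; rewrite -addr_eq0 addrC (rep_ab' rep) a'a'bv linear0 scaler0.
by rewrite linearN aab'z oppr0.
Qed.

End Thinness.

(** With [z = a' b v] and [z' = a b' z], of weights [p + 2 * h] and [p], the seven words give the
    hypotheses of [thin_or_scalar] at [v] and, mirrored, at [z], and the last one serves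
    [thin_degenerate] at [z']. Either some weight lemma applies directly or the scalar relations tie
    [v], [z], [z'] together. *)
Lemma rep_thin h L0 a b a' b' (rep : ns_rep h L0 a b a' b') p e v :
  L0 v = p *: v -> gr e v -> v != 0 ->
  a v = 0 -> a' (a' (b v)) = 0 -> b' (a (b v)) = 0 ->
  a (a (b' (a' (b v)))) = 0 -> b (a' (b' (a' (b v)))) = 0 ->
  a' (a' (b (a (b' (a' (b v)))))) = 0 ->
  b' (a (b (a (b' (a' (b v)))))) = 0 -> thin L0 p.
Proof.
move=> L0v ev v0 av a'a'bv b'abv aab'z ba'b'z a'a'bz' b'abz'.
have rep' := ns_rep_swap rep.
set z := a' (b v) in a'a'bv aab'z ba'b'z a'a'bz' b'abz'.
set z' := a (b' z) in aab'z a'a'bz' b'abz'.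
have L0z := L0_a'bw rep L0v; rewrite -/z in L0z.
have ez := homog_a'b rep ev; rewrite -/z in ez.
have back : p + 2 * h + 2 * - h = p by ring.
have L0z' := L0_a'bw rep' L0z; rewrite -/z' back in L0z'.
have ez' := homog_a'b rep' ez; rewrite -/z' in ez'.
have grv : exists e, gr e v by exists e.
have grz : exists e, gr e z by exists e.
have grz' : exists e, gr e z' by exists e.
have [z0|z0] := eqVneq z 0.
  by case: (thin_degenerate rep L0v).
have [z'0|z'0] := eqVneq z' 0.
  by case: (thin_degenerate rep' L0z) => // _; rewrite back.
have [[]//|[_ az]] := thin_or_scalar rep L0v grv av a'a'bv b'abv aab'z.
have [[_]|] := thin_or_scalar rep' L0z grz a'a'bv aab'z ba'b'z a'a'bz'.
  by rewrite back.
rewrite back -/z'; set k' := 2 * p; set al := d + k' => [[bb'z a'z']].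
have a'bu u : a u = 0 -> a' (b u) = - b (a' u).
  move=> au; apply/eqP; rewrite -addr_eq0 addrC (rep_ba' rep) au linear0.
  by rewrite scaler0.
have az' : a z' = 0 by [].
have a'bz' : a' (b z') = - (k' * al) *: z.
  by rewrite a'bu // a'z' linearZ /= bb'z scalerA scaleNr.
(* If this scalar were 0, [a z] and hence [z' = a b' z] would vanish. *)
have k0 : 2 * (p + 2 * h) != 0.
  apply: contraNneq z'0 => k0; rewrite k0 scale0r -/z in az.
  have := rep_ab' rep z; rewrite az a'a'bv !linear0 addr0 => ab'z.
  exact/eqP.
have [k'0|k'0] := eqVneq k' 0.
  rewrite k'0 mul0r oppr0 scale0r in a'bz'.
  by case: (thin_degenerate rep L0z' grz' z'0 az' a'bz' b'abz').
(* The coefficient makes [a' b w = 0], as in [thin_degenerate]; if [w] = 0, then [z'] is a multiple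
   of [v], and [v], [z] fit [thin_pair]. *)
set w := (k' * al) *: v + z'.
have [|w0] := eqVneq w 0; last first.
  case: (@thin_degenerate _ _ _ _ _ _ rep p w) => //.
  - by rewrite linearP L0v L0z' scalerDr !scalerA mulrC.
  - by exists e; apply: (rep_grP rep).
  - by rewrite linearP av az' scaler0 addr0.
  - by rewrite !linearP a'bz' -/z scaleNr subrr.
  - by rewrite !linearP b'abv b'abz' scaler0 addr0.
rewrite /w addrC => /eqP; rewrite addr_eq0 => /eqP z'E.
have bv : b v = (2 * (p + 2 * h))^-1 *: a z.
  by rewrite az scalerA mulVf // scale1r.
have b'z : b' z = - al *: a' v.
  apply: (scalerI k'0); rewrite -a'z' z'E linearN linearZ /=.
  by rewrite scalerA mulrN scaleNr.
case: (@thin_pair _ _ _ _ _ _ rep p v z 2) => //.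
- by rewrite v0.
- by exists 0, (2 * (p + 2 * h))^-1; rewrite scale0r add0r.
- by exists 0, (- al); rewrite scale0r add0r.
Qed.

End Representations.

(** * Finite-dimensional subspaces *)

Section FiniteDimension.

Variables (F : fieldType) (V : lmodType F).
Implicit Types (K : V -> Prop) (f : {linear V -> V}) (s es : seq V).

Definition fdim K :=
  exists2 s : seq V, forall x, x \in s -> K x &
    forall x, K x -> lspan (fun y => y \in s) x.

Definition subspace K := K 0 /\ forall k x y, K x -> K y -> K (k *: x + y).

Lemma span_seq_cons e es x : lspan (fun y => y \in e :: es) x ->
  exists k, lspan (fun y => y \in es) (x - k *: e).
Proof.
elim=> [|l u w ue _ [k IHw]]; first by exists 0; rewrite scale0r subr0; left.
move: ue; rewrite in_cons => /predU1P[->|ues].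
  by exists (l + k); rewrite scalerDl opprD addrACA subrr add0r.
by exists k; rewrite -addrA; apply: span_cons.
Qed.

(** Rank-nullity by induction on [es]: [K1] consists of the vectors sent into the span of the tail,
    and a single [x0] outside it supplies the missing dimension. *)
Lemma fdim_kernel1 es K f : subspace K ->
  (forall x, K x -> lspan (fun y => y \in es) (f x)) ->
  fdim (fun x => K x /\ f x = 0) -> fdim K.
Proof.
elim: es K => [|e es IHes] K Ksub Kes [s sK Ks].
  have K0 x : K x -> f x = 0 by move/Kes; elim=> // k u w.
  by exists s => [x /sK[]//|x Kx]; apply: Ks; split=> //; apply: K0.
pose K1 x := K x /\ lspan (fun y => y \in es) (f x).
have [s1 s1K Ks1] : fdim K1.
  apply: IHes => [|x []//|].
    split; first by split; [case: Ksub | rewrite linear0; left].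
    move=> k x y [Kx fx] [Ky fy]; split; first exact: Ksub.2.
    by rewrite linearP; apply: spanD => //; apply: spanZ.
  exists s => [x /sK[Kx fx]|x [[Kx _] fx]]; last exact: Ks.
  by split=> //; split=> //; rewrite fx; left.
have [[x0 Kx0 x0N]|allK1] := pselect (exists2 x, K x & ~ K1 x); last first.
  have KK1 x : K x -> K1 x.
    by move=> Kx; apply: contrapT => nKx; apply: allK1; exists x.
  by exists s1 => x; [case/s1K | move/KK1/Ks1].
have [k x0k] := span_seq_cons (Kes _ Kx0).
have k0 : k != 0.
  by apply: contra_not_neq x0N => k0; split=> //; rewrite k0 scale0r subr0 in x0k.
exists (x0 :: s1) => [x|x Kx].
  by rewrite in_cons => /predU1P[->//|/s1K[]].
have [l xl] := span_seq_cons (Kes _ Kx).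
(* [l] and [k] are coefficients of [e] in [f x] and [f x0], so [x - (l / k) *: x0] lies in [K1]. *)
rewrite -[x](subrK ((l / k) *: x0)) addrC; apply: span_cons; first exact: mem_head.
apply: span_trans (Ks1 _ _) => [y ys|].
  by apply: span_mem; rewrite in_cons ys orbT.
split; first by rewrite addrC -scaleNr; apply: Ksub.2.
have -> : f (x - (l / k) *: x0) = (f x - l *: e) - (l / k) *: (f x0 - k *: e).
  rewrite linearB linearZ /= scalerBr scalerA divfK // opprB addrA subrK.
  by [].
by apply: spanB => //; apply: spanZ.
Qed.

Lemma subspace_kernel K f : subspace K -> subspace (fun x => K x /\ f x = 0).
Proof.
move=> [K0 KP]; split=> [|k x y [Kx fx] [Ky fy]]; first by rewrite linear0.
by split; [apply: KP | rewrite linearP fx fy scaler0 addr0].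
Qed.

(** Kernels are taken one after another. The [foldr] makes a concrete list of maps unfold to plain
    conjunctions. *)
Lemma fdim_kernel (fs : seq {linear V -> V}) es K : subspace K ->
  foldr (fun f P => (forall x, K x -> lspan (fun y => y \in es) (f x)) /\ P) True fs ->
  fdim (fun x => K x /\ foldr (fun f P => f x = 0 /\ P) True fs) -> fdim K.
Proof.
elim: fs K => [|f fs IHfs] K Ksub /= => [_|[Kf Kfs]] [s sK Ks].
  by exists s => [x /sK[]|x Kx] //; apply: Ks.
apply: (fdim_kernel1 Ksub Kf); apply: IHfs.
- exact: subspace_kernel.
- elim: fs Kfs {sK Ks} => //= g fs IHfs [Kg Kfs].
  by split=> [x [/Kg]|]; last exact: IHfs.
- by exists s => [x /sK[Kx [fx]]|x [[Kx fx] fsx]] //; apply: Ks.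
Qed.

Lemma fdimU K K0 K1 : subspace K -> fdim K0 -> fdim K1 ->
  (forall x, K0 x -> K x) -> (forall x, K1 x -> K x) ->
  (forall x, K x -> exists x0 x1, [/\ K0 x0, K1 x1 & x = x0 + x1]) -> fdim K.
Proof.
move=> Ksub [s0 s0K Ks0] [s1 s1K Ks1] K0K K1K KP; exists (s0 ++ s1) => x.
  by rewrite mem_cat => /orP[/s0K/K0K|/s1K/K1K].
move=> /KP[x0 [x1 [/Ks0 x0s /Ks1 x1s ->]]].
apply: spanD; [apply: span_trans x0s|apply: span_trans x1s] => y ys.
  by apply: span_mem; rewrite mem_cat ys.
by apply: span_mem; rewrite mem_cat ys orbT.
Qed.

Lemma finite_dimP (W : {pred V}) : finite_dim W <-> fdim (fun x => x \in W).
Proof.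
split=> [[n [e [eW We]]]|[s sW Ws]].
  exists (codom e) => [x /codomP[i ->]//|x /We[c ->]].
  elim/big_ind: _ => [||i _]; [by left|exact: spanD|].
  exact/spanZ/span_mem/codom_f.
exists (size s), (fun i => s`_i); split=> [i|x /Ws]; first exact/sW/mem_nth.
elim=> [|k u w us _ [c ->]].
  by exists (fun=> 0); rewrite big1 // => i _; rewrite scale0r.
have ltus : (index u s < size s)%N by rewrite index_mem.
(* [s] may repeat [u], so [k] is added at its first index only. *)
exists (fun i => c i + (i == Ordinal ltus)%:R * k).
rewrite [RHS](eq_bigr (fun i : 'I__ =>
  c i *: s`_i + ((i == Ordinal ltus)%:R * k) *: s`_i)); last first.
  by move=> i _; rewrite scalerDl.
rewrite big_split /= addrC; congr (_ + _).
rewrite (bigD1 (Ordinal ltus)) //= eqxx mul1r nth_index // big1 ?addr0 //.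
by move=> i /negPf ->; rewrite mul0r scale0r.
Qed.

Lemma thin_fdim f mu : thin f mu -> fdim (fun x => f x = mu *: x).
Proof.
(* [v] may lie outside the eigenspace, while [fdim] asks for generators inside it. *)
move=> [v vP]; have [[x fx x0]|no] := pselect (exists2 x, f x = mu *: x & x != 0).
  exists [:: x] => [y|y /vP[l ->]]; first by rewrite inE => /eqP->.
  have [k xk] := vP _ fx; have k0 : k != 0.
    by apply: contraNneq x0 => k0; rewrite xk k0 scale0r.
  have -> : l *: v = (l / k) *: x by rewrite xk scalerA divfK.
  by apply/spanZ/span_mem/mem_head.
exists [::] => // x fx; have [->|x0] := eqVneq x 0; first by left.
by case: no; exists x.
Qed.

End FiniteDimension.

(** As [f] preserves parity, the even and odd components of [f x - mu *: x] vanish separately. *)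
Lemma graded_eigen (F : fieldType) (V : lmodType F) (gr : bool -> V -> Prop)
    (f : {linear V -> V}) mu x :
  (forall e k x y, gr e x -> gr e y -> gr e (k *: x + y)) ->
  (forall x, exists x0 x1, [/\ gr false x0, gr true x1 & x = x0 + x1]) ->
  (forall x, gr false x -> gr true x -> x = 0) ->
  (forall e x, gr e x -> gr e (f x)) -> f x = mu *: x ->
  exists x0 x1, [/\ f x0 = mu *: x0 /\ gr false x0,
    f x1 = mu *: x1 /\ gr true x1 & x = x0 + x1].
Proof.
move=> grP gr_split gr_disj f_gr fx.
have [x0 [x1 [g0 g1 xE]]] := gr_split x; exists x0, x1.
have gr_f e y : gr e y -> gr e (f y - mu *: y).
  by move=> ey; rewrite addrC -scaleNr; apply/grP/f_gr.
have gr0 : gr true 0 by rewrite -(addNr x1) -scaleN1r; apply: grP.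
have f0 : f x0 - mu *: x0 = -1 *: (f x1 - mu *: x1) + 0.
  apply/eqP; rewrite addr0 scaleN1r -addr_eq0 addrACA -linearD -opprD -scalerDr.
  by rewrite -xE fx subrr.
have fx0 : f x0 = mu *: x0.
  apply/eqP; rewrite -subr_eq0; apply/eqP/gr_disj; first exact: gr_f.
  by rewrite f0; apply/grP/gr0/gr_f.
split=> //; split=> //; apply/eqP; rewrite -subr_eq0 -oppr_eq0.
by move/esym/eqP: f0; rewrite fx0 subrr addr0 scaleN1r.
Qed.

(** * Comparing neighbouring weight spaces *)

Section InfiniteDimension.

Variables (F : numFieldType) (V : lmodType F) (gr : bool -> V -> Prop) (d h : F).
Variables (L0 a b a' b' : {linear V -> V}).
Hypothesis rep : ns_rep gr d h L0 a b a' b'.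
Hypothesis gr_split : forall x, exists x0 x1,
  [/\ gr false x0, gr true x1 & x = x0 + x1].
Hypothesis gr_disj : forall x, gr false x -> gr true x -> x = 0.
Hypothesis L0_gr : forall e x, gr e x -> gr e (L0 x).

(** Suppose the conclusion fails. In each parity the seven words of [rep_thin] then have common
    kernel 0 and map into a finite-dimensional space, so [fdim_kernel] bounds both parity parts, a
    contradiction. *)
Lemma fdim_step p : fdim (fun x => L0 x = (p + h) *: x) ->
  fdim (fun x => L0 x = p *: x).
Proof.
move=> [es _ espan]; apply: contrapT => inf.
have grP := rep_grP rep.
have subM : subspace (fun x => L0 x = p *: x).
  split=> [|k x y L0x L0y]; first by rewrite linear0 scaler0.
  by rewrite linearP L0x L0y scalerDr !scalerA mulrC.
have gr0 e : gr e 0.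
  have [x0 [x1 [g0 g1 _]]] := gr_split 0.
  case: e; [rewrite -(addNr x1)|rewrite -(addNr x0)];
    by rewrite -scaleN1r; apply: grP.
have finK e : fdim (fun x => L0 x = p *: x /\ gr e x).
  pose c (f g : {linear V -> V}) : {linear V -> V} := f \o g.
  (* In the order of the hypotheses of [rep_thin]; each word shifts the weight by [h] in total. *)
  pose fs := [:: a; c a' (c a' b); c b' (c a b);
    c a (c a (c b' (c a' b))); c b (c a' (c b' (c a' b)));
    c a' (c a' (c b (c a (c b' (c a' b)))));
    c b' (c a (c b (c a (c b' (c a' b)))))].
  apply: (@fdim_kernel _ _ fs es).
  - split=> [|k x y [L0x ex] [L0y ey]].
      by rewrite linear0 scaler0; split.
    by split; [apply: subM.2 | apply: grP].
  - have La x q : L0 x = q *: x -> L0 (a x) = (q + h) *: a x.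
      by move=> L0x; rewrite (rep_L0a rep) L0x linearZ -scalerDl.
    have Lb x q : L0 x = q *: x -> L0 (b x) = (q + 3 * h) *: b x.
      by move=> L0x; rewrite (rep_L0b rep) L0x linearZ -scalerDl.
    have La' x q : L0 x = q *: x -> L0 (a' x) = (q - h) *: a' x.
      by move=> L0x; rewrite (rep_L0a' rep) L0x linearZ -scalerBl.
    have Lb' x q : L0 x = q *: x -> L0 (b' x) = (q - 3 * h) *: b' x.
      by move=> L0x; rewrite (rep_L0b' rep) L0x linearZ -scalerBl.
    have sp y q : q = p + h -> L0 y = q *: y -> lspan (fun y => y \in es) y.
      by move=> -> /espan.
    split=> [x [/La/espan]//|].
    split=> [x [/Lb/La'/La' + _]|]; first by apply: sp; ring.
    split=> [x [/Lb/La/Lb' + _]|]; first by apply: sp; ring.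
    split=> [x [/Lb/La'/Lb'/La/La + _]|]; first by apply: sp; ring.
    split=> [x [/Lb/La'/Lb'/La'/Lb + _]|]; first by apply: sp; ring.
    split=> [x [/Lb/La'/Lb'/La/Lb/La'/La' + _]|]; first by apply: sp; ring.
    split=> [x [/Lb/La'/Lb'/La/Lb/La/Lb' + _]|//]; first by apply: sp; ring.
  - exists [::] => // x [[L0x ex] /= [k1 [k2 [k3 [k4 [k5 [k6 [k7 _]]]]]]]].
    have [->|x0] := eqVneq x 0; first by left.
    by case: inf; apply: thin_fdim; apply: (rep_thin rep L0x ex).
apply/inf/(fdimU subM (finK false) (finK true)) => [x []//|x []//|x L0x].
exact: graded_eigen grP gr_split gr_disj L0_gr L0x.
Qed.

End InfiniteDimension.

(** * The Neveu-Schwarz operators on a simple module *)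

HB.instance Definition _ (F : numFieldType) (g : lieSuperalgebra F)
    (M : superModule g) (x : g) :=
  GRing.isLinear.Build F M M *:%R (sm_act x) (sm_actr x).

Section SimpleModule.

Variables (F : numFieldType) (M : superModule (NS F)).

Let E (k : ns_basis) : NS F := << k >> : {malg F[ns_basis]}.
Let op (k : ns_basis) : {linear M -> M} := sm_act (E k).
Let hom e (v : M) : Prop := v \in sm_gr e.

Lemma op_gr k e v : hom e v -> hom (ns_parity k (+) e) (op k v).
Proof. by apply: sm_act_gr; apply: ns_grU. Qed.

Lemma sm_act0l (v : M) : sm_act (0 : NS F) v = 0.
Proof.
have /= := sm_actl v (-1) 0 0.
by rewrite scaleN1r oppr0 addr0 scaleN1r addNr.
Qed.

Lemma sm_actDl (x y : NS F) (v : M) : sm_act (x + y) v = sm_act x v + sm_act y v.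
Proof. by have /= := sm_actl v 1 x y; rewrite !scale1r. Qed.

Lemma sm_actZl k (x : NS F) (v : M) : sm_act (k *: x) v = k *: sm_act x v.
Proof. by have /= := sm_actl v k x 0; rewrite addr0 sm_act0l addr0. Qed.

Lemma sm_actNl (x : NS F) (v : M) : sm_act (- x) v = - sm_act x v.
Proof. by rewrite -!scaleN1r sm_actZl. Qed.

Lemma op_br i j v : sm_act (ns_br_table E i j) v =
  op i (op j v) - (-1) ^+ (ns_parity i && ns_parity j) *: op j (op i v).
Proof.
rewrite -sm_act_br ?ns_grU //; congr (sm_act _ v).
by rewrite -[RHS]/(ns_br _ _) ns_brU.
Qed.

Lemma op_ind (P : NS F -> Prop) : P 0 -> (forall k i x, P x -> P (k *: E i + x)) ->
  forall x, P x.
Proof. exact: ns_ind. Qed.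

Let actE := (sm_actDl, sm_actZl, sm_actNl, sm_act0l, @expr0 F, @expr1 F,
  @scale1r F M, @scaleN1r F M, @opprK M).

Lemma op_LL m n v : op (LB m) (op (LB n) v) - op (LB n) (op (LB m) v) =
  (n - m)%:~R *: op (LB (m + n)) v
  - ((m + n == 0)%:R * ((m%:~R ^+ 3 - m%:~R) / 12)) *: op CB v.
Proof. by have /= := op_br (LB m) (LB n) v; rewrite !actE => <-. Qed.

Lemma op_LG m r v : op (LB m) (op (GB r) v) - op (GB r) (op (LB m) v) =
  (Defs.half F r - m%:~R / 2) *: op (GB (m + r)) v.
Proof. by have /= := op_br (LB m) (GB r) v; rewrite !actE => <-. Qed.

Lemma op_GG r s v : op (GB r) (op (GB s) v) + op (GB s) (op (GB r) v) =
  2 *: op (LB (r + s + 1)) v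
  + ((4 * Defs.half F r ^+ 2 - 1) / 12 * (r + s + 1 == 0)%:R) *: op CB v.
Proof. by have /= := op_br (GB r) (GB s) v; rewrite !actE => <-. Qed.

Lemma op_C k v : op k (op CB v) = op CB (op k v).
Proof.
have := op_br CB k v; rewrite /= !actE => /esym/eqP.
by rewrite subr_eq0 => /eqP.
Qed.

Lemma homog_eigen (f : {linear M -> M}) mu x :
  (forall e v, hom e v -> hom e (f v)) -> x != 0 -> f x = mu *: x ->
  exists e, exists2 u, hom e u & f u = mu *: u /\ u != 0.
Proof.
have [sub split disj] := sm_grP M; move=> f_gr x0 fx.
have [|||u0 [u1 [[fu0 g0] [fu1 g1] xE]]] := graded_eigen _ _ _ f_gr fx => //.
- by move=> e k y z; apply: (sub e).2.
have [u00|u0N] := eqVneq u0 0; last by exists false, u0.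
by exists true, u1 => //; split=> //; rewrite xE u00 add0r in x0.
Qed.

Hypothesis simpleM : is_simple M.

(** Homogeneity of the vectors in [S] makes their span graded, hence a submodule to which simplicity
    applies. *)
Lemma simple_span (S : M -> Prop) : (forall x, S x -> exists e, hom e x) ->
  (forall k x, S x -> lspan S (op k x)) -> (exists2 x, S x & x != 0) ->
  forall x, lspan S x.
Proof.
move=> Sgr Sst [x Sx x0] y; pose W : {pred M} := [pred v : M | `[< lspan S v >]].
have WP v : (v \in W) = `[< lspan S v >] by [].
have [||Wall] := simpleM.2 W; last 2 first.
- by move/(_ x); rewrite WP => W0; case/eqP: x0; apply/W0/asboolP/span_mem.
- by have := Wall y; rewrite WP => /asboolP.
split=> [|v|g v]; rewrite ?WP.
- split=> [|k u w]; rewrite !WP; first by apply/asboolP; left.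
  by move=> /asboolP Su /asboolP Sw; apply/asboolP/spanD => //; apply: spanZ.
- move/asboolP; elim=> [|k u w Su _ [v0 [v1 [[W0 g0] [W1 g1] ->]]]].
    have [sub _ _] := sm_grP M; exists 0, 0; rewrite !WP addr0.
    by split=> //; split; rewrite ?(sub _).1 //; apply/asboolP; left.
  have [sub _ _] := sm_grP M; have [[] gu] := Sgr u Su.
    exists v0, (k *: u + v1); rewrite addrCA; split=> //; split.
      by rewrite WP; apply/asboolP/span_cons => //; apply/asboolP; rewrite -WP.
    by apply: (sub true).2.
  exists (k *: u + v0), v1; rewrite addrA; split=> //; split.
    by rewrite WP; apply/asboolP/span_cons => //; apply/asboolP; rewrite -WP.
  by apply: (sub false).2.
move/asboolP => Sv; apply/asboolP.
move: g; apply: op_ind => [|k i g IHg]; first by rewrite sm_act0l; left.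
rewrite sm_actDl sm_actZl; apply: spanD => //; apply: spanZ.
by apply: (span_map _ Sv) => u; apply: Sst.
Qed.

(** Some weight vector, hence some homogeneous vector, is an eigenvector of [op CB]. By centrality
    the homogeneous eigenvectors for its eigenvalue are stable, so they span the module. *)
Lemma central_charge : is_weight_module M -> exists c : F, forall v, op CB v = c *: v.
Proof.
move=> wM; have [[v v0] _] := simpleM; have [n [w [wP vE]]] := wM v.
have [i w0] : exists i, w i != 0.
  apply: contrapT => nw; case/eqP: v0; rewrite vE big1 // => i _.
  by apply/eqP; apply: contrapT => /negP wi; apply: nw; exists i.
have [c cw] : exists c : F, op CB (w i) = c *: w i.
  by apply: wP; exists 0, 1; rewrite scale0r add0r scale1r.
have [e [u gu [cu u0]]] : exists e, exists2 u, hom e u & op CB u = c *: u /\ u != 0.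
  exact: homog_eigen (op_gr CB) w0 cw.
exists c => x; pose S v := (exists e, hom e v) /\ op CB v = c *: v.
have : lspan S x.
  apply: simple_span => [y []//|k y [[e' gy] cy]|]; last first.
    by exists u => //; split=> //; exists e.
  apply/span_mem; split; first by eexists; apply: op_gr gy.
  by rewrite -op_C cy linearZ.
elim=> [|k y z [_ cy] _ cz]; first by rewrite linear0 scaler0.
by rewrite linearP cy cz scalerDr !scalerA mulrC.
Qed.

Variable c : F.
Hypothesis cP : forall v, op CB v = c *: v.

Let two0 : (2 : F) != 0. Proof. by rewrite pnatr_eq0. Qed.

(** The squares of G_(1/2) and G_(-1/2) are L_1 and L_-1; brackets with these reach every G_r, and
    [G_(1/2), G_(n-1/2)] then reaches L_n. *)
Lemma stable_generators (P : M -> Prop) :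
  (forall k x y, P x -> P y -> P (k *: x + y)) ->
  (forall r x, r \in [:: 0; 1; -1; -2] -> P x -> P (op (GB r) x)) ->
  forall k x, P x -> P (op k x).
Proof.
move=> lin gens.
have PD x y : P x -> P y -> P (x + y).
  by move=> Px Py; rewrite -[x]scale1r; apply: lin.
have PB x y : P x -> P y -> P (x - y).
  by move=> Px Py; rewrite addrC -scaleN1r; apply: lin.
have P0 x : P x -> P 0 by move=> Px; rewrite -(subrr x); apply: PB.
have PZ k x : P x -> P (k *: x).
  by move=> Px; rewrite -[_ *: _]addr0; apply/lin/(P0 _ Px).
have PV k x : k != 0 -> P (k *: x) -> P x.
  by move=> k0 /(PZ k^-1); rewrite scalerA mulVf // scale1r.
pose st k := forall x, P x -> P (op k x).
have stC : st CB by move=> x Px; rewrite cP; apply: PZ.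
have stL r s : st (GB r) -> st (GB s) -> st (LB (r + s + 1)).
  move=> Pr Ps x Px; apply: (PV 2) => //.
  have -> : 2 *: op (LB (r + s + 1)) x = op (GB r) (op (GB s) x) +
      op (GB s) (op (GB r) x) - ((4 * Defs.half F r ^+ 2 - 1) / 12 *
        (r + s + 1 == 0)%:R) *: op CB x by rewrite op_GG addrK.
  by apply: PB; [apply: PD; [apply/Pr/Ps|apply/Ps/Pr]|apply/PZ/stC].
have stG m r : Defs.half F r - m%:~R / 2 != 0 -> st (LB m) -> st (GB r) ->
    st (GB (m + r)).
  move=> mr Pm Pr x Px; apply: (PV _ _ mr).
  by rewrite -op_LG; apply: PB; [apply/Pm/Pr|apply/Pr/Pm].
have G0 : st (GB 0) by move=> x; apply: gens.
have G1 : st (GB 1) by move=> x; apply: gens.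
have GN1 : st (GB (-1)) by move=> x; apply: gens.
have GN2 : st (GB (-2)) by move=> x; apply: gens.
have L1 : st (LB 1) by exact: (stL 0 0).
have LN1 : st (LB (-1)) by exact: (stL (-1) (-1)).
(* [L_1, G_(1/2)] = 0, so the climb has to start at G_(3/2). *)
have Gpos n : st (GB n%:Z).
  elim: n => [|[|n] IHn] //; have -> : n.+2%:Z = 1 + n.+1%:Z by lia.
  apply: stG => //; have -> : Defs.half F n.+1%:Z - 1%:~R / 2 = n.+1%:~R.
    by rewrite /Defs.half mulr1z; field.
  by rewrite intr_eq0.
have Gneg n : st (GB (- n.+1%:Z)).
  elim: n => [|[|n] IHn] //.
  have -> : - n.+3%:Z = - 1 + - n.+2%:Z by lia.
  apply: stG => //; have -> : Defs.half F (- n.+2%:Z) - (-1)%:~R / 2 = (- n.+1%:Z)%:~R.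
    rewrite /Defs.half !rmorphN /= mulr1z.
    have -> : n.+2%:Z = n.+1%:Z + 1 by lia.
    by rewrite rmorphD /= mulr1z; field.
  by rewrite intr_eq0; lia.
have stGB r : st (GB r).
  case: r => n; first exact: Gpos.
  by rewrite NegzE; apply: Gneg.
move=> [n||r] x Px; [|exact: stC|exact: stGB].
have -> : n = 0 + (n - 1) + 1 by lia.
by apply: stL => //.
Qed.

Lemma simple_rep : ns_rep hom (2 / 3 * c) 2^-1 (op (LB 0)) (op (GB 0)) (op (GB 1))
  (op (GB (-1))) (op (GB (-2))).
Proof.
have GG r x : op (GB r) (op (GB r) x) = op (LB (r + r + 1)) x.
  apply: (scalerI two0); rewrite scaler_nat mulr2n op_GG.
  case: eqP => [|_]; first by lia.
  by rewrite mulr0 scale0r addr0.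
(* Index [r] = 0 is G_(1/2), where the central coefficient vanishes; at G_(3/2) it is 2/3, the
   factor in [d]. *)
have GG0 r s x : (r + s + 1 != 0) || (r == 0) -> op (GB r) (op (GB s) x) +
    op (GB s) (op (GB r) x) = 2 *: op (LB (r + s + 1)) x.
  move=> rs; rewrite op_GG; have -> : (4 * Defs.half F r ^+ 2 - 1) / 12 *
    (r + s + 1 == 0)%:R = 0 :> F; last by rewrite scale0r addr0.
  by case/orP: rs => [/negPf->|/eqP->]; rewrite /Defs.half /=; field.
have LL m n x : m + n != 0 -> op (LB m) (op (LB n) x) - op (LB n) (op (LB m) x) =
    (n - m)%:~R *: op (LB (m + n)) x.
  by move=> /negPf mn; rewrite op_LL mn mul0r scale0r subr0.
have LG r x : op (LB 0) (op (GB r) x) =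
    op (GB r) (op (LB 0) x) + Defs.half F r *: op (GB r) x.
  by apply/eqP; rewrite addrC -subr_eq op_LG mul0r subr0 add0r.
split.
- by rewrite invr_eq0.
- by move=> x; rewrite GG0.
- by move=> x; rewrite GG0 // GG.
- by move=> x; rewrite addrC GG0 // GG.
- move=> x; rewrite op_GG cP scalerA; congr (_ + _ *: _).
  by rewrite /Defs.half /=; field.
- by move=> x; rewrite LG /Defs.half; congr (_ + _ *: _); field.
- by move=> x; rewrite LG /Defs.half; congr (_ + _ *: _); field.
- by move=> x; rewrite LG -scaleNr /Defs.half; congr (_ + _ *: _); field.
- by move=> x; rewrite LG -scaleNr /Defs.half; congr (_ + _ *: _); field.
- move=> x; rewrite !GG !GG0 // linearZ /= -scalerBr LL //.
  by rewrite scalerA; congr (_ *: _); field.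
- move=> x; rewrite !GG !GG0 // linearZ /= -scalerBr LL //.
  by rewrite scalerA -scaleNr; congr (_ *: _); field.
- by move=> e x /(op_gr (GB 0)).
- by move=> e x /(op_gr (GB 1)).
- by move=> e x /(op_gr (GB (-1))).
- by move=> e x /(op_gr (GB (-2))).
- by move=> e k x y; have [sub _ _] := sm_grP M; apply: (sub e).2.
move=> S Sgr Sst; apply: simple_span => // k x Sx.
apply: (@stable_generators (lspan S)) => [{}k y z Sy Sz|r y|].
- by apply: spanD => //; apply: spanZ.
- rewrite !inE => /or4P[] /eqP->; apply: span_map => z /Sst[] //.
- exact: span_mem.
Qed.

End SimpleModule.

(** * Weight spaces and support *)

Lemma infinite_weight_spaces (F : numFieldType) (M : superModule (NS F)) lambda :
  is_simple M -> is_weight_module M -> ~ finite_dim (weight_space M lambda) ->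
  forall n : int, ~ finite_dim (weight_space M (lambda + n%:~R / 2)).
Proof.
move=> sM wM inf; have [c cP] := central_charge sM wM.
have rep := simple_rep sM cP; set L0 := (X in ns_rep _ _ _ X) in rep.
have [sub sp disj] := sm_grP M.
have fdE mu : finite_dim (weight_space M mu) <-> fdim (fun x => L0 x = mu *: x).
  rewrite finite_dimP; suff -> : (fun x => x \in weight_space M mu) =
    (fun x => L0 x = mu *: x) :> (M -> Prop) by [].
  by apply/funext => x; apply/propext; split=> /eqP.
have L0gr e x : x \in sm_gr e -> L0 x \in sm_gr e by exact: (@op_gr _ M (LB 0)).
(* Read contrapositively, [up] and its mirror image [down] carry infinite dimension to the two
   neighbouring weights. *)
have up p : fdim (fun x => L0 x = (p + 2^-1) *: x) -> fdim (fun x => L0 x = p *: x).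
  exact: (fdim_step rep).
have down p : fdim (fun x => L0 x = (p - 2^-1) *: x) -> fdim (fun x => L0 x = p *: x).
  exact: (fdim_step (ns_rep_swap rep)).
have pos (n : nat) : ~ finite_dim (weight_space M (lambda + n%:R / 2)).
  elim: n => [|n IHn]; first by rewrite mul0r addr0.
  by rewrite fdE -natr1 mulrDl mul1r addrA => /up/fdE.
have neg (n : nat) : ~ finite_dim (weight_space M (lambda - n%:R / 2)).
  elim: n => [|n IHn]; first by rewrite mul0r subr0.
  by rewrite fdE -natr1 mulrDl mul1r opprD addrA => /down/fdE.
case=> n; first exact: pos.
by rewrite NegzE rmorphN mulNr; apply: neg.
Qed.

(** The homogeneous vectors with weight in lambda + Z/2 are stable under the generators, hence span
    [M]; [span_eigen_neq] excludes any other weight. *)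
Lemma supp_subset (F : numFieldType) (M : superModule (NS F)) lambda mu :
  is_simple M -> is_weight_module M -> supp M lambda -> supp M mu ->
  exists n : int, mu = lambda + n%:~R / 2.
Proof.
move=> sM wM [u ul u0] [w /eqP wmu w0]; have [c cP] := central_charge sM wM.
have rep := simple_rep sM cP; set L0 := (X in ns_rep _ _ _ X) in rep.
apply: contrapT => nmu; case/eqP: w0.
have grL0 e x : x \in sm_gr e -> L0 x \in sm_gr e := @op_gr _ M (LB 0) e x.
have [e [v gv [lv v0]]] := homog_eigen grL0 u0 (eqP ul).
pose S x := (exists e, x \in sm_gr e) /\
  exists n : int, L0 x = (lambda + n%:~R / 2) *: x.
(* [k] is twice the weight of the generator: 1, 3, -1 or -3. *)
have shift x y (k : int) e' : y \in sm_gr e' -> S x ->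
    (forall s, L0 x = s *: x -> L0 y = (s + k%:~R / 2) *: y) -> lspan S y.
  move=> gy [_ [n /[swap]/[apply] yw]]; apply: span_mem; split; first by exists e'.
  by exists (n + k); rewrite yw -addrA -mulrDl rmorphD.
have Sw : lspan S w.
  apply: (rep_irr rep) => [x []//|x Sx|]; last first.
    by exists v => //; split; [exists e | exists 0; rewrite mul0r addr0].
  have [[e' gx] [n xw]] := Sx; split.
  - by rewrite [L0 x]xw; apply/spanZ/span_mem.
  - apply: (shift x _ 1) (rep_gra rep gx) Sx _ => s xs.
    by rewrite (rep_L0a rep) [L0 x]xs linearZ -scalerDl mul1r.
  - apply: (shift x _ 3) (rep_grb rep gx) Sx _ => s xs.
    by rewrite (rep_L0b rep) [L0 x]xs linearZ -scalerDl.
  - apply: (shift x _ (-1)) (rep_gra' rep gx) Sx _ => s xs.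
    by rewrite (rep_L0a' rep) [L0 x]xs linearZ -scalerBl mulN1r.
  - apply: (shift x _ (-3)) (rep_grb' rep gx) Sx _ => s xs.
    by rewrite (rep_L0b' rep) [L0 x]xs linearZ -scalerBl mulNr.
apply: span_eigen_neq Sw wmu => x [_ [n xw]]; exists (lambda + n%:~R / 2) => //.
by apply: contra_not_neq nmu => <-; exists n.
Qed.

Theorem theorem1 (R : realType) (M : superModule (NS R[i])) (lambda : R[i]) :
  is_simple M ->
  is_weight_module M ->
  ~ finite_dim (weight_space M lambda) ->
  supp M = [set lambda + k | k in half_integers R[i]]%classic /\
  (forall k, half_integers R[i] k ->
    ~ finite_dim (weight_space M (lambda + k))).
Proof.
move=> sM wM inf; have inf_half := infinite_weight_spaces sM wM inf.
have inf_supp mu : ~ finite_dim (weight_space M mu) -> supp M mu.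
  move=> muN; apply: contrapT => nsupp; apply: muN.
  (* A zero weight space is spanned by the empty family. *)
  exists 0, (fun=> 0); split=> [[]//|v vmu]; exists (fun=> 0).
  rewrite big_ord0; apply/eqP; apply: contrapT => /negP v0.
  by apply: nsupp; exists v.
split; last by move=> _ [n _ <-]; apply: inf_half.
apply/seteqP; split=> [mu|_ [_ [n _ <-] <-]]; last exact/inf_supp/inf_half.
move=> /(supp_subset sM wM (inf_supp _ inf))[n ->].
by exists (n%:~R / 2) => //; exists n.
Qed.
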